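(* For any convex polyhedron $P$ in $\mathbb{R}^3$, $$1<\frac{\mathrm{diam}(P)}{\mathrm{rad}(P)}\leq 2.$$ The second inequality is sharp, and equality in it is achieved by $\varepsilon$-thick tetrahedra for small $\varepsilon$ (that is, there is $\varepsilon_0>0$ such that $\mathrm{diam}(T)=2\,\mathrm{rad}(T)$ for every $\varepsilon$-thick tetrahedron $T$ with $0<\varepsilon<\varepsilon_0$).
   Context: A convex polyhedron (in particular a tetrahedron) is identified with its surface. For a convex surface $S\subset\mathbb{R}^3$, $\mathrm{diam}(S)=\max_{x,y\in S}\|x-y\|$ is the extrinsic diameter and $\mathrm{rad}(S)=\min_{x\in S}\max_{y\in S}\|x-y\|$ the extrinsic radius (the minimum being over points of the surface $S$), with $\|\cdot\|$ the Euclidean norm. For $\varepsilon>0$, an $\varepsilon$-thick tetrahedron is a tetrahedron $T$ with one edge included in a ball of radius $\varepsilon\,\mathrm{diam}(T)$ centered at the midpoint of its longest edge. *)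

(* Defs.v *)
From HB Require Import structures.
From mathcomp Require Import all_boot all_order all_algebra.
From mathcomp Require Import all_classical all_reals all_analysis.

Set Implicit Arguments.
Unset Strict Implicit.
Unset Printing Implicit Defensive.

Import Order.TTheory GRing.Theory Num.Theory.
Import numFieldNormedType.Exports.

Local Open Scope classical_set_scope.
Local Open Scope ring_scope.

(* The canonical norm on ['rV[R]_n] is the sup norm, so the Euclidean one is
   defined here; both induce the same topology, and [closure], [interior] below
   are those of the canonical structure. *)
Definition enorm (R : realType) (n : nat) (u : 'rV[R]_n) : R :=
  Num.sqrt (\sum_i u ord0 i ^+ 2).

Definition eball (R : realType) (n : nat) (c : 'rV[R]_n) (r : R)
    : set 'rV[R]_n :=
  [set x | enorm (x - c) <= r].

Definition hull (R : realType) (n : nat) (A : set 'rV[R]_n) : set 'rV[R]_n :=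
  smallest (@convex_set R 'rV[R]_n) A.

Definition boundary (T : topologicalType) (A : set T) : set T :=
  closure A `\` interior A.

(* Polyhedra and tetrahedra are identified with their surfaces. *)
Definition convex_polyhedron (R : realType) (P : set 'rV[R]_3) : Prop :=
  exists V : set 'rV[R]_3,
    [/\ finite_set V, interior (hull V) !=set0 & P = boundary (hull V)].

(* Extrinsic diameter and radius: on the nonempty compact surfaces considered
   here the suprema and the infimum are attained, i.e. they are the max and
   min of the usual definitions. *)
Definition ext_diam (R : realType) (n : nat) (S : set 'rV[R]_n) : R :=
  sup [set enorm (x - y) | x in S & y in S].

Definition ext_rad (R : realType) (n : nat) (S : set 'rV[R]_n) : R :=
  inf [set sup [set enorm (x - y) | y in S] | x in S].

Definition aff_indep4 (R : realType) (v : 'I_4 -> 'rV[R]_3) : Prop :=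
  row_free (\matrix_(i < 3) (v (lift ord0 i) - v ord0)).

Definition tetrahedron (R : realType) (v : 'I_4 -> 'rV[R]_3)
    : set 'rV[R]_3 :=
  boundary (hull (range v)).

Definition midpoint (R : realType) (n : nat) (x y : 'rV[R]_n) : 'rV[R]_n :=
  2^-1 *: (x + y).

Definition longest_edge (R : realType) (v : 'I_4 -> 'rV[R]_3) (i j : 'I_4)
    : Prop :=
  i != j /\ forall k l : 'I_4, enorm (v k - v l) <= enorm (v i - v j).

(* The longest edge need not be unique: any one of them may serve. *)
Definition thick_tetrahedron (R : realType) (eps : R) (T : set 'rV[R]_3)
    : Prop :=
  exists v : 'I_4 -> 'rV[R]_3,
    [/\ aff_indep4 v, T = tetrahedron v &
        exists i j k l : 'I_4,
          [/\ longest_edge v i j, k != l &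
              hull [set v k; v l]
                `<=` eball (midpoint (v i) (v j)) (eps * ext_diam T)]].

(* Main.v *)
(** Let [K] be the convex hull of the vertices and [D] the diameter of [P],
    which is also that of [K].  Some point [x] of [P] is not a vertex, because [P] is
    infinite; it then lies strictly inside a segment [[a, b]] of [K], and
    Stewart's theorem bounds all its distances to [K] uniformly below [D].  The
    upper bound is the triangle inequality.  The ratio is [2] for a tetrahedron
    as soon as the ball whose diameter is one of the edges contains all
    vertices, since the midpoint of that edge is on the surface; this holds for
    [eps]-thick tetrahedra with [eps < 1/2]. *)
Require Import Defs.
From HB Require Import structures.
From mathcomp Require Import all_boot all_order all_algebra.
From mathcomp Require Import all_classical all_reals all_analysis.
From mathcomp Require Import zify ring lra.

Set Implicit Arguments.
Unset Strict Implicit.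
Unset Printing Implicit Defensive.

Import Order.TTheory GRing.Theory Num.Theory.
Import numFieldNormedType.Exports.

Local Open Scope classical_set_scope.
Local Open Scope ring_scope.

(** * The Euclidean norm on row vectors *)

Section EuclideanNorm.
Variables (R : realType) (n : nat).
Implicit Types (x y z u : 'rV[R]_n) (t r : R).

Lemma enorm_ge0 u : 0 <= enorm u.
Proof. exact: sqrtr_ge0. Qed.

Lemma sqr_enorm u : enorm u ^+ 2 = \sum_i u ord0 i ^+ 2.
Proof. by rewrite sqr_sqrtr// sumr_ge0// => i _; exact: sqr_ge0. Qed.

Lemma enormN u : enorm (- u) = enorm u.
Proof. by congr Num.sqrt; apply: eq_bigr => i _; rewrite mxE sqrrN. Qed.

Lemma enorm_distC x y : enorm (x - y) = enorm (y - x).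
Proof. by rewrite -enormN opprB. Qed.

Lemma enormZ t u : enorm (t *: u) = `|t| * enorm u.
Proof.
rewrite -sqrtr_sqr -sqrtrM ?sqr_ge0//; congr Num.sqrt.
by rewrite mulr_sumr; apply: eq_bigr => i _; rewrite mxE exprMn.
Qed.

Lemma enorm_gt0 u : (0 < enorm u) = (u != 0).
Proof.
rewrite lt_def enorm_ge0 andbT; congr (~~ _); apply/eqP/eqP => [u0|->].
  have : \sum_i u ord0 i ^+ 2 = 0 by rewrite -sqr_enorm u0 expr0n.
  move/eqP; rewrite psumr_eq0 => [/allP s0|i _]; last exact: sqr_ge0.
  apply/rowP => i; rewrite mxE.
  by have := s0 i (mem_index_enum i); rewrite sqrf_eq0 => /eqP.
by rewrite /enorm big1 ?sqrtr0// => i _; rewrite mxE expr0n.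
Qed.

Lemma enorm_ler_sqr u r : 0 <= r -> (enorm u <= r) = (enorm u ^+ 2 <= r ^+ 2).
Proof. by move=> r0; rewrite ler_sqr// nnegrE enorm_ge0. Qed.

(* Stewart's theorem *)
Lemma sqr_enorm_conv t x y z :
  enorm (t *: x + (1 - t) *: y - z) ^+ 2 =
  t * enorm (x - z) ^+ 2 + (1 - t) * enorm (y - z) ^+ 2
  - t * (1 - t) * enorm (x - y) ^+ 2.
Proof.
rewrite !sqr_enorm !mulr_sumr -sumrN -!big_split/=.
by apply: eq_bigr => i _; rewrite !mxE; ring.
Qed.

(** By Stewart's theorem at the midpoint ([t = 2^-1]), nonnegativity of the left side bounds
    [enorm (x - y) ^+ 2] by twice the sum of the squared distances to [z]. This is the form in which
    the triangle inequality is used below. *)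
Lemma enorm_le_double x y z r :
  enorm (x - z) <= r -> enorm (y - z) <= r -> enorm (x - y) <= 2 * r.
Proof.
move=> xz yz.
have r0 : 0 <= r by exact: le_trans (enorm_ge0 _) xz.
move: xz yz; rewrite !enorm_ler_sqr ?mulr_ge0// => xz yz.
have := sqr_enorm_conv 2^-1 x y z.
have := sqr_ge0 (enorm (2^-1 *: x + (1 - 2^-1) *: y - z)).
by move=> + eq; rewrite {}eq; lra.
Qed.

End EuclideanNorm.

(** * Convex hulls and compactness *)

Section ConvexHull.
Variables (R : realType) (n : nat).
Implicit Types (A B : set 'rV[R]_n) (x y z u v : 'rV[R]_n) (s t r : R).

Lemma convex_setP A : @convex_set R 'rV[R]_n A <->
  forall x y t, 0 <= t <= 1 -> A x -> A y -> A (t *: x + (1 - t) *: y).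
Proof.
split=> [cA x y t t01 Ax Ay|cA x y t /[!inE] Ax Ay].
  have /andP[t0 t1] := t01.
  have := cA x y (Itv01 t0 t1) (mem_set Ax) (mem_set Ay).
  by rewrite inE.
by apply: cA => //; apply/andP; split.
Qed.

Lemma sub_hull A : A `<=` hull A.
Proof. exact: sub_gen_smallest. Qed.

Lemma hull_min A B : @convex_set R 'rV[R]_n B -> A `<=` B -> hull A `<=` B.
Proof. by move=> cB; exact: smallest_sub. Qed.

Lemma convex_hull A : @convex_set R 'rV[R]_n (hull A).
Proof.
apply/convex_setP => x y t t01 Ax Ay B [cB AB].
by move/convex_setP : (cB); apply => //; [exact: Ax|exact: Ay].
Qed.

Lemma hull_conv A x y t : 0 <= t <= 1 -> hull A x -> hull A y ->
  hull A (t *: x + (1 - t) *: y).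
Proof. by move: x y t; apply/convex_setP; exact: convex_hull. Qed.

Lemma convex_eball z r : @convex_set R 'rV[R]_n (eball z r).
Proof.
apply/convex_setP => x y t /andP[t0 t1]; rewrite /eball/= => xz yz.
have r0 : 0 <= r by exact: le_trans (enorm_ge0 _) xz.
move: xz yz; rewrite !enorm_ler_sqr// => xz yz.
(* The term subtracted in Stewart's theorem is nonnegative, so the squared distance is at most a
   convex combination of two numbers below [r ^+ 2]. *)
rewrite sqr_enorm_conv.
have : 0 <= t * (1 - t) * enorm (x - y) ^+ 2.
  by rewrite mulr_ge0 ?sqr_ge0// mulr_ge0 ?subr_ge0.
have := ler_wpM2l t0 xz.
have : (1 - t) * enorm (y - z) ^+ 2 <= (1 - t) * r ^+ 2.
  by rewrite ler_wpM2l ?subr_ge0.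
by lra.
Qed.

(** The union of the segments from [v] to [hull A] is already convex. Writing it as a continuous
    image of a product lets compactness of finite hulls go by induction on the vertices. *)
Lemma hull_set1U v A : A !=set0 -> hull (v |` A) =
  (fun p : R * 'rV[R]_n => p.1 *: v + (1 - p.1) *: p.2) @`
    (`[0, 1] `*` hull A).
Proof.
move=> [a Aa]; apply/seteqP; split.
  apply: hull_min.
    apply/convex_setP => _ _ s /andP[s0 s1]
      [[t x] [/= t01 Ax] <-] [[t' y] [/= t'01 Ay] <-].
    move: t01 t'01; rewrite !in_itv/= => /andP[t0 t1] /andP[t'0 t'1].
    (* The total weight carried by [x] and [y], the rest being on [v]. If it vanishes, the
       combination is [v] itself; otherwise one divides by it. *)
    set w := s * (1 - t) + (1 - s) * (1 - t').
    have st0 : 0 <= s * (1 - t) by rewrite mulr_ge0// subr_ge0.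
    have st'0 : 0 <= (1 - s) * (1 - t') by rewrite mulr_ge0// subr_ge0.
    have [w0|w0] := eqVneq w 0.
      have e1 : s * (1 - t) = 0 by move: w0; rewrite /w; lra.
      have e2 : (1 - s) * (1 - t') = 0 by move: w0; rewrite /w; lra.
      exists (1, x); rewrite /= ?in_itv/= ?lexx ?ler01//.
      apply/rowP => i; rewrite !mxE.
      move: (x _ _) (y _ _) (v _ _) => xi yi vi.
      transitivity (vi + s * (1 - t) * (xi - vi)
                    + (1 - s) * (1 - t') * (yi - vi)); last by ring.
      by rewrite e1 e2; ring.
    have wgt0 : 0 < w by rewrite lt_def w0/= addr_ge0.
    exists (1 - w, (s * (1 - t) / w) *: x + (1 - s * (1 - t) / w) *: y).
      split => /=.
        rewrite in_itv/= subr_ge0 gerBl (ltW wgt0) andbT /w.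
        have := mulr_ge0 s0 t0.
        have : 0 <= (1 - s) * t' by rewrite mulr_ge0// subr_ge0.
        by lra.
      apply: hull_conv => //; rewrite divr_ge0 ?(ltW wgt0)//=.
      by rewrite ler_pdivrMr// mul1r /w lerDl.
    apply/rowP => i; rewrite !mxE.
    move: (x _ _) (y _ _) (v _ _) => xi yi vi /=.
    have -> : 1 - s * (1 - t) / w = (1 - s) * (1 - t') / w.
      by rewrite /w; field.
    transitivity ((1 - w) * vi + s * (1 - t) * xi + (1 - s) * (1 - t') * yi).
      by field.
    by rewrite /w; ring.
  move=> x [->|Ax].
    exists (1, a); last by rewrite /= scale1r subrr scale0r addr0.
    by split => /=; [rewrite in_itv/= lexx ler01|exact: sub_hull].
  exists (0, x); last by rewrite /= scale0r subr0 scale1r add0r.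
  by split => /=; [rewrite in_itv/= lexx ler01|exact: sub_hull].
move=> _ [[t x] [/= + Ax] <-]; rewrite in_itv/= => t01.
apply: hull_conv => //; first by apply: sub_hull; left.
by apply: hull_min x Ax => [|y Ay]; [exact: convex_hull|apply: sub_hull; right].
Qed.

Lemma compact_hull A : finite_set A -> compact (hull A).
Proof.
move=> /finite_seqP[s ->{A}]; elim: s => [|v s IHs].
  rewrite (_ : hull _ = set0); first exact: compact0.
  apply/seteqP; split => //; apply: hull_min => [|//].
  by apply/convex_setP => x y t _ [].
have -> : [set` v :: s] = v |` [set` s].
  apply/seteqP; split => x /=; rewrite inE.
    by move=> /orP[/eqP|]; [left|right].
  by move=> [->|->]; rewrite ?eqxx ?orbT.
have [->|s0] := eqVneq [set` s] set0.
  rewrite setU0 (_ : hull _ = [set v]); first exact: compact_set1.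
  apply/seteqP; split => [|x ->]; last exact: sub_hull.
  apply: hull_min => //; apply/convex_setP => x y t _ -> ->.
  by rewrite -scalerDl addrC subrK scale1r.
rewrite hull_set1U; last exact/set0P.
apply: continuous_compact; last first.
  by apply: compact_setX => //; exact: segment_compact.
apply: continuous_subspaceT => p.
apply: cvgD; apply: cvgZ.
- exact: cvg_fst.
- exact: cvg_cst.
- by apply: cvgB; [exact: cvg_cst|exact: cvg_fst].
- exact: cvg_snd.
Qed.

Lemma hull_enorm_bounded A : finite_set A -> exists r, hull A `<=` eball 0 r.
Proof.
(* The sum of the norms dominates each of them, also for an empty list. *)
move=> /finite_seqP[s ->{A}]; exists (\sum_(v <- s) enorm v).
apply: hull_min; first exact: convex_eball.
move=> v /= vs; rewrite /eball/= subr0 (big_rem v)//= lerDl.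
by rewrite sumr_ge0// => w _; exact: enorm_ge0.
Qed.

End ConvexHull.

(** * Extrinsic diameter and radius of bounded sets *)

Section DiameterRadius.
Variables (R : realType) (n : nat).
Implicit Types (S : set 'rV[R]_n) (x y : 'rV[R]_n) (d r : R).

Lemma eball0_dist S r x y : S `<=` eball 0 r -> S x -> S y ->
  enorm (x - y) <= 2 * r.
Proof.
move=> Sr /Sr Sx /Sr Sy.
by apply: (@enorm_le_double _ _ _ _ 0); [exact: Sx|exact: Sy].
Qed.

Lemma ext_diam_ge S r x y : S `<=` eball 0 r -> S x -> S y ->
  enorm (x - y) <= ext_diam S.
Proof.
move=> Sr Sx Sy; apply: ub_le_sup; last by exists x => //; exists y.
by exists (2 * r) => _ [a Sa [b Sb <-]]; exact: (eball0_dist Sr).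
Qed.

Lemma ext_diam_le S d : S !=set0 ->
  (forall x y, S x -> S y -> enorm (x - y) <= d) -> ext_diam S <= d.
Proof.
move=> [x Sx] Sd; apply: ge_sup.
  by exists (enorm (x - x)), x => //; exists x.
by move=> _ [a Sa [b Sb <-]]; exact: Sd.
Qed.

Let ecc_ge S r x y : S `<=` eball 0 r -> S x -> S y ->
  enorm (x - y) <= sup [set enorm (x - z) | z in S].
Proof.
move=> Sr Sx Sy; apply: ub_le_sup; last by exists y.
by exists (2 * r) => _ [b Sb <-]; exact: (eball0_dist Sr).
Qed.

Lemma ext_rad_le S r x d : S `<=` eball 0 r -> S x ->
  (forall y, S y -> enorm (x - y) <= d) -> ext_rad S <= d.
Proof.
move=> Sr Sx Sd; apply: (@le_trans _ _ (sup [set enorm (x - z) | z in S])).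
  apply: ge_inf; last by exists x.
  exists 0 => _ [y Sy <-].
  exact: le_trans (enorm_ge0 _) (ecc_ge Sr Sy Sx).
apply: ge_sup; first by exists (enorm (x - x)), x.
by move=> _ [y Sy <-]; exact: Sd.
Qed.

Lemma ext_diam_le_double_rad S r : S `<=` eball 0 r -> S !=set0 ->
  ext_diam S <= 2 * ext_rad S.
Proof.
move=> Sr S0; rewrite mulrC -ler_pdivrMr//.
have [x Sx] := S0; apply: lb_le_inf.
  by exists (sup [set enorm (x - y) | y in S]), x.
move=> _ [z Sz <-]; rewrite ler_pdivrMr// mulrC.
apply: ext_diam_le => // a b Sa Sb; apply: (@enorm_le_double _ _ _ _ z).
  by rewrite enorm_distC; exact: (ecc_ge Sr Sz Sa).
by rewrite enorm_distC; exact: (ecc_ge Sr Sz Sb).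
Qed.

End DiameterRadius.

(** * Finding boundary points *)

Section Boundary.
Variables (R : realType) (n : nat).
Implicit Types (A : set 'rV[R]_n) (c u x : 'rV[R]_n) (t r : R).

(** Restricting neighbourhoods to a line turns the closure and interior arguments below into
    estimates on one real parameter. *)
Lemma nbhs_line c u t A : nbhs (c + t *: u) A ->
  exists2 e, 0 < e & forall s, `|s| < e -> A (c + (t + s) *: u).
Proof.
move=> cA.
have : (fun s => c + (t + s) *: u) @ 0 --> c + (t + 0) *: u.
  apply: cvgD; first exact: cvg_cst.
  by apply: cvgZ; [apply: cvgD; [exact: cvg_cst|exact: cvg_id]|exact: cvg_cst].
rewrite addr0 => /(_ _ cA) /nbhs_ballP[e /= e0 eA]; exists e => // s se.
by apply: eA; rewrite /ball/= sub0r normrN.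
Qed.

Lemma closed_boundary_sub A : closed A -> boundary A `<=` A.
Proof. by move=> cA x [+ _]; rewrite -(closure_id A).1. Qed.

Lemma boundary_on_ray A c u r : A `<=` eball 0 r -> (interior A) c -> u != 0 ->
  exists2 t, 0 < t & boundary A (c + t *: u).
Proof.
move=> Ar cA u0; have Ac : A c by exact: interior_subset.
(* [sup E] is where the ray leaves [A] for the last time: parameters in [E] come arbitrarily close
   to it, so the point is in the closure, and none lies beyond, so it is not interior. *)
pose E := [set t | 0 <= t /\ A (c + t *: u)].
have E_ub : has_ubound E.
  exists (2 * r / enorm u) => t [t0 At].
  rewrite ler_pdivlMr ?enorm_gt0// -(ger0_norm t0) -enormZ.
  have -> : t *: u = c + t *: u - c by rewrite addrAC subrr add0r.
  exact: (eball0_dist Ar).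
have E0 : E !=set0 by exists 0; split; rewrite ?scale0r ?addr0.
have t0 : 0 < sup E.
  have : nbhs (c + 0 *: u) A by rewrite scale0r addr0.
  move=> /nbhs_line[e e0 eA].
  apply: (@lt_le_trans _ _ (e / 2)); first by rewrite divr_gt0.
  apply: ub_le_sup => //; split; first by rewrite divr_ge0 ?ltW.
  by rewrite -[_ / _]add0r; apply: eA; rewrite gtr0_norm ?divr_gt0//; lra.
exists (sup E) => //; split.
  move=> B /nbhs_line[e e0 eB].
  have [t [tge At] te] := sup_adherent e0 (conj E0 E_ub).
  exists (c + t *: u); split => //.
  have -> : t = sup E + (t - sup E) by lra.
  apply: eB; rewrite ltr_norml; apply/andP; split; first by lra.
  have : t <= sup E by exact: ub_le_sup.
  by lra.
move=> /nbhs_line[e e0 eA].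
suff : sup E + e / 2 <= sup E by lra.
apply: ub_le_sup => //; split; first by rewrite addr_ge0 ?divr_ge0// ltW.
by apply: eA; rewrite gtr0_norm ?divr_gt0//; lra.
Qed.

(** Moving from [x] along [u] makes [g] negative at once, hence leaves [A]. For a tetrahedron [g]
    will be a barycentric coordinate. *)
Lemma supporting_boundary A (g : 'rV[R]_n -> R) x u : A x ->
  (forall y, A y -> 0 <= g y) -> (forall t, g (x + t *: u) = - t) ->
  boundary A x.
Proof.
move=> Ax Ag gE; split; first exact: subset_closure.
move=> xA; have : nbhs (x + 0 *: u) A by rewrite scale0r addr0.
move=> /nbhs_line[e e0 eA].
have /Ag : A (x + (0 + e / 2) *: u).
  by apply: eA; rewrite gtr0_norm ?divr_gt0//; lra.
by rewrite gE; lra.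
Qed.

End Boundary.

(** * Boundaries, hulls and nonextreme points *)

(** An interior point lies between the boundary points found on two opposite rays from it; positive
    dimension provides a nonzero direction. It transfers diameter bounds from the surface to the
    solid. *)
Lemma sub_hull_boundary (R : realType) n (A : set 'rV[R]_n.+1) r :
  A `<=` eball 0 r -> A `<=` hull (boundary A).
Proof.
move=> Ar x Ax; have [xA|xA] := pselect ((interior A) x); last first.
  by apply: sub_hull; split => //; exact: subset_closure.
have u0 : (const_mx 1 : 'rV[R]_n.+1) != 0.
  by apply/eqP => /rowP/(_ ord0); rewrite !mxE; apply/eqP; exact: oner_neq0.
have [t t0 tA] := boundary_on_ray Ar xA u0.
have [s s0 sA] : exists2 s, 0 < s & boundary A (x - s *: const_mx 1).
  rewrite -oppr_eq0 in u0; have [s s0] := boundary_on_ray Ar xA u0.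
  by rewrite scalerN; exists s.
have ts0 : 0 < s + t by exact: addr_gt0.
(* The weights are chosen so that the offsets [t] and [- s] cancel. *)
rewrite [X in hull _ X](_ : x = (s / (s + t)) *: (x + t *: const_mx 1) +
                 (1 - s / (s + t)) *: (x - s *: const_mx 1)); last first.
  by apply/rowP => i; rewrite !mxE; field; rewrite gt_eqF.
apply: hull_conv; try exact: sub_hull.
rewrite divr_ge0 ?(ltW s0) ?(ltW ts0)//=.
by rewrite ler_pdivrMr// mul1r lerDl ltW.
Qed.

Lemma infinite_boundary (R : realType) n (A : set 'rV[R]_n.+2) r :
  A `<=` eball 0 r -> interior A !=set0 -> infinite_set (boundary A).
Proof.
move=> Ar [c cA].
(* No two of these directions are parallel, so the boundary points on their rays are distinct: the
   first coordinate determines [t k], then the last one determines [k]. *)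
pose u (k : nat) : 'rV[R]_n.+2 := \row_j (if j == ord0 then 1 else k%:R).
have u0 k : u k != 0.
  by apply/eqP => /rowP/(_ ord0); rewrite !mxE; apply/eqP; exact: oner_neq0.
have /choice[t tP] k : exists t, 0 < t /\ boundary A (c + t *: u k).
  by have [t t0 tA] := boundary_on_ray Ar cA (u0 k); exists t.
move=> finA; apply: infinite_nat.
have -> : [set: nat] = (fun k => c + t k *: u k) @^-1` boundary A.
  by apply/seteqP; split => k _ //; exact: (tP k).2.
apply: finite_preimage finA => j k _ _ /addrI /rowP eq_tu.
have := eq_tu ord0; rewrite !mxE/= !mulr1 => tjk.
have := eq_tu ord_max; rewrite !mxE/= tjk => /mulfI.
rewrite gt_eqF ?(tP k).1// => /(_ isT) /eqP.
by rewrite eqr_nat => /eqP.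
Qed.

(** Otherwise [hull V] without [x] would still be convex and contain [V], against minimality of the
    hull. *)
Lemma hull_nonextreme (R : realType) n (V : set 'rV[R]_n) x :
  hull V x -> ~ V x -> exists a b t,
    [/\ hull V a, hull V b, a != b, 0 < t < 1 & x = t *: a + (1 - t) *: b].
Proof.
move=> Kx Vx; apply: contrapT => nex.
suff : (hull V `\ x) x by case=> _; apply.
apply: (@hull_min _ _ V (hull V `\ x)) (Kx); last first.
  by move=> v Vv; split; [exact: sub_hull|move=> /= vx; apply: Vx; rewrite -vx].
apply/convex_setP => a b t /andP[t0 t1] [Ka /eqP ax] [Kb /eqP bx].
split; first by apply: hull_conv => //; rewrite t0.
move=> /= xE; apply: nex; exists a, b, t; split => //.
- apply/eqP => ab; move: xE; rewrite -ab -scalerDl addrC subrK scale1r.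
  by move/eqP; rewrite (negbTE ax).
- rewrite !lt_def t0 t1 !andbT; apply/andP; split; apply/eqP => tE.
    by move/eqP: xE; rewrite tE scale0r add0r subr0 scale1r (negbTE bx).
  by move/eqP: xE; rewrite -tE subrr scale0r addr0 scale1r (negbTE ax).
Qed.

(** Balls are convex, so one passes from [S] to its hull one argument at a time. *)
Lemma sub_hull_dist (R : realType) n (S : set 'rV[R]_n) d :
  (forall x y, S x -> S y -> enorm (x - y) <= d) ->
  forall x y, hull S x -> hull S y -> enorm (x - y) <= d.
Proof.
move=> Sd x y Kx Ky; rewrite enorm_distC.
apply: (hull_min (@convex_eball _ _ x d)) Ky.
move=> z Sz; rewrite /eball/= enorm_distC.
apply: (hull_min (@convex_eball _ _ z d)) Kx.
by move=> w Sw; exact: Sd.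
Qed.

Lemma hull_boundary_bounded (R : realType) n (V : set 'rV[R]_n) :
  finite_set V -> boundary (hull V) `<=` hull V /\
  exists r, hull V `<=` eball 0 r.
Proof.
move=> finV; split; last exact: hull_enorm_bounded.
apply: closed_boundary_sub; apply: compact_closed; last exact: compact_hull.
exact: norm_hausdorff.
Qed.

Lemma finite_range_ord n (T : choiceType) (v : 'I_n -> T) :
  finite_set (range v).
Proof. by apply: finite_image; exact: finite_finset. Qed.

(** * Edges of tetrahedra and thick tetrahedra *)

Section Tetrahedra.
Variable R : realType.
Implicit Types (v : 'I_4 -> 'rV[R]_3) (i j k l : 'I_4).

(** The barycentric coordinate of a vertex off the edge is nonnegative on the solid and zero on the
    edge, so it supports the solid there. The case [i = j] yields the vertices. *)
Lemma tetrahedron_edge v i j (t : R) : aff_indep4 v -> 0 <= t <= 1 ->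
  tetrahedron v (t *: v i + (1 - t) *: v j).
Proof.
rewrite /aff_indep4 row_free_unit; set M := \matrix_(_ < _) _ => Mu t01.
have [a /andP[ai aj]] :
    exists a : 'I_3, (lift ord0 a != i) && (lift ord0 a != j).
  apply/existsP; apply: contraT; rewrite negb_exists => /forallP aij.
  have : (#|[set lift ord0 a | a : 'I_3]%SET| <= #|[set i; j]%SET|)%N.
    apply/subset_leq_card/fintype.subsetP => _ /imsetP[a _ ->].
    by have := aij a; rewrite !inE negb_and !negbK.
  rewrite card_imset ?card_ord; last exact: lift_inj.
  by rewrite cards2; case: (_ != _).
(* The barycentric coordinate attached to [v (lift ord0 a)]. *)
pose g x := ((x - v ord0) *m invmx M) ord0 a.
have gv k : g (v k) = (k == lift ord0 a)%:R.
  rewrite /g; case: (unliftP ord0 k) => [b|] ->.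
    have -> : v (lift ord0 b) - v ord0 = row b M by rewrite rowK.
    rewrite -row_mul mulmxV// rowE mulmx1 mxE eqxx/= (inj_eq lift_inj).
    by rewrite eq_sym.
  by rewrite subrr mul0mx mxE (negbTE (neq_lift _ _)).
have gconv x y s : g (s *: x + (1 - s) *: y) = s * g x + (1 - s) * g y.
  rewrite /g.
  have -> : s *: x + (1 - s) *: y - v ord0 =
      s *: (x - v ord0) + (1 - s) *: (y - v ord0).
    by apply/rowP => b; rewrite !mxE; ring.
  by rewrite mulmxDl -!scalemxAl !mxE.
(* Along this direction [g] decreases at unit rate, since it is [0] at [v ord0] and [1] at the other
   vertex. *)
apply: (@supporting_boundary _ _ _ g _ (v ord0 - v (lift ord0 a))).
- by apply: hull_conv => //; apply: sub_hull; eexists.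
- apply: (@hull_min _ _ _ [set y | 0 <= g y]) => [|_ [k _ <-]/=].
    apply/convex_setP => x y s /andP[s0 s1] /= gx gy.
    by rewrite gconv addr_ge0// mulr_ge0// subr_ge0.
  by rewrite gv ler0n.
- move=> s; set x := _ + _ *: v j.
  have gx : g x = 0.
    rewrite gconv !gv ![_ == lift _ _]eq_sym (negbTE ai) (negbTE aj).
    by rewrite !mulr0 addr0.
  have -> : g (x + s *: (v ord0 - v (lift ord0 a))) =
      g x - s * g (v (lift ord0 a)).
    rewrite /g; set w := v (lift _ _).
    have -> : x + s *: (v ord0 - w) - v ord0 = (x - v ord0) - s *: (w - v ord0).
      by apply/rowP => b; rewrite !mxE; ring.
    by rewrite mulmxBl -scalemxAl !mxE.
  by rewrite gx gv eqxx mulr1 sub0r.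
Qed.

Lemma tetrahedron_diam_rad v i j : aff_indep4 v ->
  (forall k, enorm (v k - midpoint (v i) (v j)) <= enorm (v i - v j) / 2) ->
  ext_diam (tetrahedron v) = 2 * ext_rad (tetrahedron v).
Proof.
move=> av vm; rewrite /tetrahedron.
have [TK [r Kr]] := hull_boundary_bounded (finite_range_ord v).
have Tr := subset_trans TK Kr.
have Ti : tetrahedron v (v i).
  rewrite [v i](_ : _ = 1 *: v i + (1 - 1) *: v i).
    by apply: tetrahedron_edge; rewrite ?ler01 ?lexx.
  by rewrite subrr scale1r scale0r addr0.
have Tj : tetrahedron v (v j).
  rewrite [v j](_ : _ = 1 *: v j + (1 - 1) *: v j).
    by apply: tetrahedron_edge; rewrite ?ler01 ?lexx.
  by rewrite subrr scale1r scale0r addr0.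
have Tm : tetrahedron v (midpoint (v i) (v j)).
  have -> : midpoint (v i) (v j) = 2^-1 *: v i + (1 - 2^-1) *: v j.
    by apply/rowP => a; rewrite !mxE; field.
  by apply: tetrahedron_edge => //; lra.
apply/eqP; rewrite eq_le (ext_diam_le_double_rad Tr)/=; last by exists (v i).
apply: le_trans (ext_diam_ge Tr Ti Tj).
rewrite mulrC -ler_pdivlMr//; apply: (ext_rad_le Tr Tm) => y /TK Ky.
rewrite enorm_distC.
apply: (hull_min (@convex_eball _ _ (midpoint (v i) (v j)) _)) Ky.
by move=> _ [k _ <-]; exact: vm.
Qed.

(** The ends of the short edge are strictly inside the ball whose diameter is the longest edge,
    while the ends of the latter are on its sphere. The two edges are therefore disjoint and account
    for all four vertices. *)
Lemma thick_tetrahedron_diam_rad (eps : R) (T : set 'rV[R]_3) :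
  eps < 2^-1 -> 0 < eps -> thick_tetrahedron eps T ->
  ext_diam T = 2 * ext_rad T.
Proof.
move=> eps2 eps0 [v [av -> [i [j [k [l [[ij vij] kl klm]]]]]]].
have [TK [r Kr]] := hull_boundary_bounded (finite_range_ord v).
set m := midpoint _ _ in klm; set L := enorm (v i - v j) in vij.
have diamL : ext_diam (tetrahedron v) <= L.
  apply: ext_diam_le.
    exists (1 *: v i + (1 - 1) *: v i).
    by apply: tetrahedron_edge; rewrite ?ler01 ?lexx.
  move=> x y /TK Kx /TK Ky; apply: sub_hull_dist Kx Ky.
  by move=> _ _ [a _ <-] [b _ <-]; exact: vij.
have L0 : 0 < L.
  (* If the longest edge had length zero, all vertices would coincide and the matrix in [aff_indep4]
     would have rank zero. *)
  rewrite lt_def enorm_ge0 andbT; apply/eqP => L0.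
  have vE a b : v a = v b.
    apply/eqP; rewrite -subr_eq0; apply: contraT; rewrite -enorm_gt0 ltNge.
    by rewrite -L0 vij.
  move: av; rewrite /aff_indep4 /row_free.
  rewrite (_ : \matrix_(_ < _) _ = 0) ?mxrank0//.
  by apply/row_matrixP => a; rewrite rowK row0 (vE _ ord0) subrr.
have im : enorm (v i - m) = L / 2.
  rewrite (_ : v i - m = 2^-1 *: (v i - v j)); last first.
    by apply/rowP => a; rewrite !mxE; field.
  by rewrite enormZ gtr0_norm// mulrC.
have jm : enorm (v j - m) = L / 2.
  rewrite (_ : v j - m = 2^-1 *: (v j - v i)); last first.
    by apply/rowP => a; rewrite !mxE; field.
  by rewrite enormZ gtr0_norm// mulrC enorm_distC.
have klL x : [set v k; v l] x -> enorm (x - m) < L / 2.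
  move=> /sub_hull /klm /le_lt_trans; apply.
  have : eps * ext_diam (tetrahedron v) <= eps * L by rewrite ler_pM2l.
  have : eps * L < 2^-1 * L by rewrite ltr_pM2r.
  by lra.
have neq a b : enorm (v a - m) < L / 2 -> enorm (v b - m) = L / 2 -> a != b.
  by move=> + bm; apply: contraTneq => ->; rewrite bm ltxx.
have kL : enorm (v k - m) < L / 2 by apply: klL; left.
have lL : enorm (v l - m) < L / 2 by apply: klL; right.
have [ki kj] := (neq _ _ kL im, neq _ _ kL jm).
have [li lj] := (neq _ _ lL im, neq _ _ lL jm).
apply: (tetrahedron_diam_rad (i := i) (j := j) av) => q.
have : [|| q == i, q == j, q == k | q == l].
  move: ij kl ki kj li lj; rewrite -!(inj_eq val_inj)/=.
  move: (ltn_ord i) (ltn_ord j) (ltn_ord k) (ltn_ord l) (ltn_ord q).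
  by lia.
by move=> /or4P[] /eqP->; rewrite -/m -/L ?im ?jm// ltW.
Qed.

End Tetrahedra.

(** * An explicit tetrahedron of ratio 2 *)

Section RightTetrahedron.
Variable R : realType.

(** With [e0], [e1], [e2] the standard basis, the vertices are [-e0], [e0], [e1], [e2]: all on the
    unit sphere, of which the edge from [-e0] to [e0] is a diameter. *)
Definition right_vertex (k : 'I_4) : 'rV[R]_3 :=
  if unlift ord0 k is Some a then delta_mx 0 a else - delta_mx 0 ord0.

Let right_vertex0 : right_vertex ord0 = - delta_mx 0 ord0.
Proof. by rewrite /right_vertex unlift_none. Qed.

Let right_vertexS a : right_vertex (lift ord0 a) = delta_mx 0 a.
Proof. by rewrite /right_vertex liftK. Qed.

Lemma aff_indep4_right_vertex : aff_indep4 right_vertex.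
Proof.
(* The rows are [e_a + e0], so the matrix is lower triangular with diagonal 2, 1, 1. *)
rewrite /aff_indep4 row_free_unit unitmxE det_trig.
  rewrite unitfE; apply/prodf_neq0 => i _.
  rewrite mxE right_vertexS right_vertex0 opprK !mxE !eqxx/=.
  by rewrite gt_eqF// ltr_pwDl// ler0n.
apply/is_trig_mxP => i j ij.
rewrite mxE right_vertexS right_vertex0 opprK !mxE/=.
have -> : (j == i) = false by rewrite gt_eqF.
have -> : (j == ord0) = false by apply/negbTE; case: j ij => -[].
by rewrite addr0.
Qed.

Lemma right_vertex_diam_rad : ext_diam (tetrahedron right_vertex) =
  2 * ext_rad (tetrahedron right_vertex).
Proof.
apply: (@tetrahedron_diam_rad _ _ (lift ord0 ord0) ord0).
  exact: aff_indep4_right_vertex.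
have delta1 a : enorm (delta_mx 0 a : 'rV[R]_3) = 1.
  rewrite /enorm (bigD1 a)//= big1 => [|i ia].
    by rewrite mxE !eqxx expr1n addr0 sqrtr1.
  by rewrite mxE (negbTE ia) andbF expr0n.
move=> k; rewrite right_vertexS right_vertex0.
have -> : midpoint (delta_mx 0 ord0) (- delta_mx 0 ord0) = 0 :> 'rV[R]_3.
  by rewrite /midpoint subrr scaler0.
rewrite subr0 opprK -mulr2n -scaler_nat enormZ delta1 normr_nat mulr1 divff//.
by case: (unliftP ord0 k) => [a|] ->;
  rewrite ?right_vertexS ?right_vertex0 ?enormN delta1.
Qed.

Lemma interior_right_vertex : interior (hull (range right_vertex)) !=set0.
Proof.
pose i0 : 'I_3 := ord0; pose i1 : 'I_3 := lift ord0 ord0.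
pose i2 : 'I_3 := ord_max.
(* The centroid; within sup distance [8^-1] of it all barycentric coordinates stay positive. *)
pose c : 'rV[R]_3 := 4^-1 *: (delta_mx 0 i1 + delta_mx 0 i2).
exists c; apply/nbhs_ballP; exists 8^-1 => /= [|x cx].
  by rewrite invr_gt0.
have xb a : `|c ord0 a - x ord0 a| < 8^-1 by case: cx => _ /(_ ord0 a).
have := xb i0; have := xb i1; have := xb i2; rewrite !mxE/= => {xb}.
rewrite !ltr_norml => /andP[x2 x2'] /andP[x1 x1'] /andP[x0 x0'].
(* [s] is the weight of [x] on [e1] and [e2], and [w] the share of [e0] in the remaining weight. *)
pose s := x ord0 i1 + x ord0 i2.
pose w := (1 - s + x ord0 i0) / (2 * (1 - s)).
have vE k : hull (range right_vertex) (right_vertex k) by exact: sub_hull.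
have -> : x = s *: ((x ord0 i1 / s) *: right_vertex (lift ord0 i1)
                    + (1 - x ord0 i1 / s) *: right_vertex (lift ord0 i2))
  + (1 - s) *: (w *: right_vertex (lift ord0 i0)
                 + (1 - w) *: right_vertex ord0).
  rewrite !right_vertexS right_vertex0.
  apply/rowP => a; rewrite !mxE/= /w /s.
  have [->|[->|->]] : a = i0 \/ a = i1 \/ a = i2.
    by case: a => -[|[|[|//]]] ?; [left|right; left|right; right];
      exact: val_inj.
  - by rewrite /=; field; apply/andP; split; rewrite gt_eqF//; lra.
  - by rewrite /=; field; apply/andP; split; rewrite gt_eqF//; lra.
  - by rewrite /=; field; apply/andP; split; rewrite gt_eqF//; lra.
have s0 : 0 < s by rewrite /s; lra.
have s1 : 0 < 1 - s by rewrite /s; lra.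
apply: hull_conv; first by apply/andP; split; lra.
- apply: hull_conv => //; apply/andP; split.
    by rewrite divr_ge0 ?(ltW s0)//; lra.
  by rewrite ler_pdivrMr// /s; lra.
- apply: hull_conv => //; apply/andP; split.
    by rewrite /w divr_ge0 ?mulr_ge0 ?(ltW s1)// /s; lra.
  by rewrite /w ler_pdivrMr ?mulr_gt0// /s; lra.
Qed.

End RightTetrahedron.

(** * The two bounds on the ratio, and sharpness *)

Lemma diam_rad_ratio (R : realType) (P : set 'rV[R]_3) : convex_polyhedron P ->
  1 < ext_diam P / ext_rad P <= 2.
Proof.
move=> [V [finV intV ->]]; set P' := boundary _.
have [PK [r Kr]] := hull_boundary_bounded finV.
have Pr := subset_trans PK Kr.
have [x [Px Vx]] : exists x, P' x /\ ~ V x.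
  apply: contrapT => nex; apply: (infinite_boundary Kr intV).
  apply: sub_finite_set finV => x Px; apply: contrapT => Vx.
  by apply: nex; exists x.
have K_diam y z : hull V y -> hull V z -> enorm (y - z) <= ext_diam P'.
  move=> /(sub_hull_boundary Kr) Ky /(sub_hull_boundary Kr) Kz.
  by apply: sub_hull_dist Ky Kz => ? ?; exact: ext_diam_ge Pr.
have [a [b [t [Ka Kb ab t01 xE]]]] := hull_nonextreme (PK _ Px) Vx.
have /andP[t0 t1] := t01.
set D := ext_diam P' in K_diam *.
have ab0 : 0 < enorm (a - b) by rewrite enorm_gt0 subr_eq0.
have D0 : 0 < D by exact: lt_le_trans (K_diam _ _ Ka Kb).
have D2r : D <= 2 * ext_rad P' by apply: ext_diam_le_double_rad Pr _; exists x.
have r0 : 0 < ext_rad P' by lra.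
(* The term subtracted in Stewart's theorem. It does not depend on [y], so the bound
   [Num.sqrt (D ^+ 2 - e)] survives the supremum over [y] and stays strictly below [D]. *)
pose e := t * (1 - t) * enorm (a - b) ^+ 2.
have e0 : 0 < e by rewrite !mulr_gt0 ?subr_gt0 ?exprn_gt0.
rewrite ltr_pdivlMr// mul1r ler_pdivrMr// D2r andbT.
apply: (@le_lt_trans _ _ (Num.sqrt (D ^+ 2 - e))).
  apply: (ext_rad_le Pr Px) => y /PK Ky.
  rewrite -[enorm _]ger0_norm ?enorm_ge0// -sqrtr_sqr ler_wsqrtr//.
  rewrite xE sqr_enorm_conv lerB//.
  have := K_diam _ _ Ka Ky; have := K_diam _ _ Kb Ky.
  rewrite !enorm_ler_sqr ?(ltW D0)// => bD aD.
  have := ler_wpM2l (ltW t0) aD.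
  have : (1 - t) * enorm (b - y) ^+ 2 <= (1 - t) * D ^+ 2.
    by rewrite ler_pM2l ?subr_gt0.
  by lra.
rewrite -[ltRHS]gtr0_norm// -sqrtr_sqr ltr_sqrt ?exprn_gt0//.
by lra.
Qed.

Theorem proposition3 (R : realType) :
  [/\ (forall P : set 'rV[R]_3, convex_polyhedron P ->
         1 < ext_diam P / ext_rad P <= 2),
      (exists P : set 'rV[R]_3,
         convex_polyhedron P /\ ext_diam P / ext_rad P = 2) &
      (exists eps0 : R, 0 < eps0 /\
         forall eps : R, 0 < eps < eps0 ->
         forall T : set 'rV[R]_3, thick_tetrahedron eps T ->
           ext_diam T = 2 * ext_rad T)].
Proof.
split.
- exact: diam_rad_ratio.
- have polT : convex_polyhedron (tetrahedron (@right_vertex R)).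
    exists (range (@right_vertex R)); split => //.
      exact: finite_range_ord.
    exact: interior_right_vertex.
  exists (tetrahedron (@right_vertex R)); split => //.
  (* The strict lower bound excludes radius 0, for which the quotient would be 0 by convention. *)
  have := diam_rad_ratio polT; rewrite right_vertex_diam_rad.
  have [->|r0 _] := eqVneq (ext_rad (tetrahedron (@right_vertex R))) 0.
    by rewrite mulr0 mul0r ltr10.
  by rewrite mulfK.
- exists 2^-1; split; first by rewrite invr_gt0.
  move=> eps /andP[eps0 eps2] T; exact: thick_tetrahedron_diam_rad eps2 eps0.
Qed.
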